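(* Let $v,w\in T_q$ be two vertices connected by an edge, and let $f$ be a $C^{v-w}$-horosummable function on $T_q$. Then $$ f(v)=\int_{\partial C^{v-w}}\left[\sum_{i=0}^{\infty}(q+1)^i\big(\gamma_i(\infty)+q^\infty\gamma_i(-\infty)\big)\triangle^i f(t)\right]dt, $$ that is, $$ f(v)=\lim_{n\to\infty}\sum_{i=0}^{n}(q+1)^i\big(\gamma_i(n)+q^n\gamma_i(-n)\big)\,\triangle^i f(C^{v-w}_n), $$ where the $\gamma_i$ are the polynomials whose coefficients solve the linear system given in the context. In addition, the condition that the horocyclic integral on the right-hand side converges to $f(v)$ is equivalent to the condition that $f$ is $C^{v-w}$-horosummable.
   Context: $T_q$ is the infinite homogeneous tree in which every vertex has $q+1$ neighbors; $v\sim w$ means that $v,w$ are joined by an edge. The Laplace operator on functions on the vertices of $T_q$ is $\triangle f(v)=\frac{1}{q+1}\sum_{w\sim v}f(w)-f(v)$; $\triangle^i$ is its $i$-th iterate and $\triangle^0$ is the identity. $S_n(v)$ is the set of vertices at distance $n$ from $v$. For $v,w$ joined by an edge $e$, the maximal proper cone $C^{v-w}$ is the connected component of $T_q\setminus e$ containing $v$, and $C^{v-w}_n=C^{v-w}\cap S_n(v)$. For a function $g:T_q\to\mathbb R$ put $g(C^{v-w}_n)=\frac1{q^n}\sum_{u\in C^{v-w}_n}g(u)$; $\triangle^i f(C^{v-w}_n)$ denotes this expression for $g=\triangle^i f$. Horocyclic integral: for arbitrary functions $\lambda_i$ on the set of positive integers, $$\int_{\partial C^{v-w}}\Big[\sum_{i=0}^\infty\lambda_i(\infty)\triangle^if(t)\Big]dt=\lim_{n\to\infty}\Big(\sum_{i=0}^n\lambda_i(n)\,\triangle^if(C^{v-w}_n)\Big).$$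 $f$ is $C^{v-w}$-horosummable if $\lim_{n\to\infty}q^nf(C^{v-w}_{2n})=\lim_{n\to\infty}\sum_{u\in C^{v-w}_{2n}}\frac{f(u)}{q^n}=0$. The polynomials $\gamma_i$: for each $i\ge0$, $\gamma_i(n)=c_{i,i}n^i+\dots+c_{i,1}n+c_{i,0}$, where (for fixed $i$) the collection $(c_{i,i},\dots,c_{i,1},c_{i,0})$ is the solution of the linear system $$\sum_{m=0}^{i}j^m\big(1+(-1)^mq^j\big)c_{i,m}=\begin{cases}0,&0\le j\le i-1,\\1,&j=i,\end{cases}\qquad j=0,1,\dots,i,$$ with the convention $0^0=1$ (so the equation for $j=0$ has left-hand side $2c_{i,0}$).
   Formalization: The equation for i=j=0 is corrected to 2c_{0,0}=2, so that γ_0=1 (with right-hand side 1, γ_0=1/2 and the formula fails), and q≥2 is assumed, because for q=1 the linear system for γ_1 has no solution. *)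

(* Defs.v *)
From HB Require Import structures.
From mathcomp Require Export all_boot all_order all_algebra.
From mathcomp Require Export all_classical all_reals all_analysis.
Export Order.TTheory GRing.Theory Num.Theory.
Export numFieldNormedType.Exports.

Set Implicit Arguments.
Unset Strict Implicit.
Unset Printing Implicit Defensive.

Local Open Scope classical_set_scope.
Local Open Scope ring_scope.

(* Any graph satisfying this predicate is a copy of T_q.  It is automatically
   infinite when q >= 1 and nonempty.  [ucycle] also counts x :: y :: nil, for
   an edge {x, y}, as a cycle, hence the bound on the size. *)
Definition homogeneous_tree (V : choiceType) (adj : rel V) (q : nat) : Prop :=
  [/\ symmetric adj,
      irreflexive adj,
      forall x y : V, exists2 p : seq V, path adj x p & last x p = y,
      forall c : seq V, ucycle adj c -> (size c <= 2)%N
    & forall x : V, ([set y | adj x y] #= `I_q.+1)%card].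

Definition sphere (V : choiceType) (adj : rel V) (n : nat) (v : V) : set V :=
  [set u | (exists p : seq V, [/\ path adj v p, last v p = u & size p = n]) /\
           (forall p : seq V, path adj v p -> last v p = u -> (n <= size p)%N)].

Definition delete_edge (V : choiceType) (adj : rel V) (v w : V) : rel V :=
  fun x y => adj x y &&
    ~~ ((x == v) && (y == w) || (x == w) && (y == v)).

Definition cone (V : choiceType) (adj : rel V) (v w : V) : set V :=
  [set u | exists2 p : seq V, path (delete_edge adj v w) v p & last v p = u].

Definition cone_sphere (V : choiceType) (adj : rel V) (v w : V) (n : nat) :
    set V :=
  cone adj v w `&` sphere adj n v.

Section Horocyclic.
Context (R : realType) (V : choiceType) (adj : rel V) (q : nat).
Implicit Types (f g : V -> R) (v w : V).

(* The sums over sets of vertices are finitely supported sums; in a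
   homogeneous tree all the sets of vertices involved are finite. *)
Definition laplace f : V -> R :=
  fun v => (q.+1%:R)^-1 * (\sum_(w \in [set w | adj v w]) f w) - f v.

Definition cone_mean g v w (n : nat) : R :=
  (q%:R ^+ n)^-1 * \sum_(u \in cone_sphere adj v w n) g u.

(* [horocyclic_integral_is v w lambda f l]: the limit defining the integral
   over the boundary of C^{v-w} of sum_i lambda_i(oo) Delta^i f exists and is
   equal to l. *)
Definition horocyclic_integral_is v w (lambda : nat -> nat -> R) f (l : R) :
    Prop :=
  (\sum_(i < n.+1) lambda i n * cone_mean (iter i laplace f) v w n)
    @[n --> \oo] --> l.

Definition horosummable v w f : Prop :=
  (q%:R ^+ n * cone_mean f v w (2 * n)%N) @[n --> \oo] --> (0 : R).

(* [is_gamma i p]: p = c_{i,i} X^i + ... + c_{i,0} and its coefficients solve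
   the linear system.  For i = 0 the only equation is 2 c_{0,0} = 2, that is,
   gamma_0 = 1: with right-hand side 1 in that equation gamma_0 would be 1/2
   and the inversion formula would fail.  Indeed what is used is
     f(v) + q^n f(C_{2n}) = sum_{i <= n} (q+1)^i
                            (gamma_i(n) + q^n gamma_i(-n)) Delta^i f(C_n),
   and constant functions f force gamma_0(n) + q^n gamma_0(-n) = 1 + q^n. *)
Definition is_gamma (i : nat) (p : {poly R}) : Prop :=
  (size p <= i.+1)%N /\
  forall j : nat, (j <= i)%N ->
    \sum_(m < i.+1) j%:R ^+ m * (1 + (-1) ^+ m * q%:R ^+ j) * p`_m
    = if (j < i)%N then 0 else if i == 0%N then 2 else 1.

Definition gamma_weight (gamma : nat -> {poly R}) (i n : nat) : R :=
  q.+1%:R ^+ i *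
    ((gamma i).[n%:R] + q%:R ^+ n * (gamma i).[- n%:R]).

End Horocyclic.

(* Main.v *)
Require Import Defs.
From mathcomp Require Import ring lra zify.

(** Both implications follow from one exact identity, valid for every [f] and
    every [n] without any summability assumption ([gamma_weight_sum] below):

      sum_(i <= n) (q+1)^i (gamma_i(n) + q^n gamma_i(-n)) Delta^i f(C_n)
        = f(v) + q^n f(C_{2n}).

    The left-hand side is the n-th term of the horocyclic integral and the last
    summand is the n-th term of the horosummability condition, so one tends to
    f(v) exactly when the other tends to 0.

    On the tree side, a vertex of C_{n+1} has one neighbour in C_n and q in
    C_{n+2}.  Summing over C_{n+1} ([cone_mean_laplace]) shows that
    (q+1) Delta acts on the sequence of cone means away from the root as
    q E - (q+1) + E^-1, where E is the shift n |-> n+1.  The combinatorics rest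
    on two facts: every edge of a tree is a bridge ([acyclic_bridge]), and hence
    a vertex has at most one neighbour that is not farther from v than itself
    ([upward_neighbor_unique]).

    On the algebraic side, put x = q E, y = E^-1 and T = x + y - (q+1), so that
    x y = q.  The identity is then the expansion in powers of T of
    x^n + y^n = q^n E^n + E^-n, a symmetric function of x and y and so a
    polynomial of degree n in T.  Solving y^2 - (T+q+1) y + q = 0 with y = 1 at
    T = 0 makes y a power series in T; the coefficient of T^i in y^n is a
    polynomial gamma_i(n) of degree at most i, and x^n = q^n y^-n contributes
    q^n gamma_i(-n).  No power series is needed to carry this out: the recursion
    y^{n+1} = (T+q+1) y^n - q y^{n-1} says that the gamma_i are linked by
    gamma_i(n+1) - (q+1) gamma_i(n) + q gamma_i(n-1) = gamma_{i-1}(n), which is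
    [gamma_radial_diff].  The operator [radial_diff q] maps a solution of the
    i-th linear system to a solution of the previous one ([radial_diff_gamma]).
    Since q <> 1, on polynomials it lowers the degree by exactly one;
    injectivity modulo constants gives uniqueness of the solutions, surjectivity
    gives existence, and uniqueness then shows that [radial_diff q] links
    consecutive gamma_i.  [gamma_inversion] follows by induction along the
    three-term recursion for x^n + y^n. *)

Set Implicit Arguments.
Unset Strict Implicit.
Unset Printing Implicit Defensive.

Local Open Scope classical_set_scope.
Local Open Scope ring_scope.

(** * The radial difference operator on polynomials *)

Section Shift.
Context (R : realType).
Implicit Types (p : {poly R}) (c q : R).

Lemma coef_exp_XaddC_pred c n : (('X + c%:P) ^+ n.+1)`_n = n.+1%:R * c :> R.
Proof.
elim: n => [|n IHn]; first by rewrite expr1 coefD coefX coefC /= add0r mul1r.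
have lead1 : (('X + c%:P) ^+ n.+1)`_n.+1 = 1 :> R.
  have /monicP := monic_exp n.+1 (monicXaddC c).
  by rewrite lead_coefE -[c%:P]opprK -polyCN size_exp_XsubC.
rewrite exprSr mulrDr coefD coefMX coefMC /= IHn lead1.
by rewrite -[n.+2%:R]natr1; ring.
Qed.

(** First-order Taylor expansion, read on coefficients: when [p] has degree at
    most n+1, only its two top coefficients reach degree n. *)
Lemma coef_comp_XaddC_pred p c n : (size p <= n.+2)%N ->
  (p \Po ('X + c%:P))`_n = p`_n + n.+1%:R * c * p`_n.+1.
Proof.
move=> sz_p; rewrite coef_comp_poly.
rewrite (big_ord_widen _ (fun i => p`_i * (('X + c%:P) ^+ i)`_n) sz_p).
rewrite big_mkcond.
under eq_bigr => i _.
  rewrite (_ : (if _ then _ else _) = p`_i * (('X + c%:P) ^+ i)`_n); last first.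
    by case: ltnP => // le_pi; rewrite nth_default // mul0r.
  over.
rewrite !big_ord_recr /= big1 ?add0r => [|i _]; last first.
  rewrite [X in _ * X]nth_default ?mulr0 //.
  by rewrite -[c%:P]opprK -polyCN size_exp_XsubC.
have /monicP := monic_exp n (monicXaddC c).
rewrite lead_coefE -[c%:P]opprK -polyCN size_exp_XsubC /= polyCN opprK => ->.
by rewrite coef_exp_XaddC_pred; ring.
Qed.

(** This is q E^-1 - (q+1) + E, the mirror image under n |-> -n of the operator
    q E - (q+1) + E^-1 by which (q+1) times the Laplacian acts on cone means. *)
Definition radial_diff q p : {poly R} :=
  (p \Po ('X + 1%:P)) - (q + 1) *: p + q *: (p \Po ('X + (-1)%:P)).

Lemma horner_radial_diff q p x :
  (radial_diff q p).[x] = p.[x + 1] - (q + 1) * p.[x] + q * p.[x - 1].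
Proof. by rewrite /radial_diff !hornerE !horner_comp !hornerE. Qed.

(** The weights 1, -(q+1), q of the three translates add up to 0, so the
    zeroth-order terms cancel; the first-order ones add up to the factor 1 - q,
    which is why q <> 1 is required further on. *)
Lemma coef_radial_diff q p n : (size p <= n.+2)%N ->
  (radial_diff q p)`_n = (1 - q) * n.+1%:R * p`_n.+1.
Proof.
move=> sz_p; rewrite !coefD coefN !coefZ !coef_comp_XaddC_pred //; ring.
Qed.

Lemma size_radial_diff q p n :
  (size p <= n.+1)%N -> (size (radial_diff q p) <= n)%N.
Proof.
move=> sz_p; apply/leq_sizeP => j le_nj.
rewrite coef_radial_diff; last by rewrite (leq_trans sz_p) // ltnS ltnW.
by rewrite [p`_ _]nth_default ?mulr0 // (leq_trans sz_p).
Qed.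

Lemma radial_diffB q p1 p2 :
  radial_diff q (p1 - p2) = radial_diff q p1 - radial_diff q p2.
Proof. rewrite /radial_diff !raddfB /=; ring. Qed.

Lemma radial_diff_eq0 q p : q != 1 -> radial_diff q p = 0 ->
  (size p <= 1)%N.
Proof.
move=> q_neq1 p_ker; case sz_p: (size p) => [|[|n]] //.
have /eqP: (radial_diff q p)`_n = 0 by rewrite p_ker coef0.
rewrite coef_radial_diff ?sz_p // !mulf_eq0 subr_eq0 eq_sym (negPf q_neq1).
by rewrite pnatr_eq0 /= -[n.+1]/(n.+2.-1) -sz_p -lead_coefE lead_coef_eq0
  -size_poly_eq0 sz_p.
Qed.

(** The leading term is lowered by exactly one degree, so a preimage is found one
    monomial at a time, starting from the top; only monomials of positive degree
    are used, whence the value 0 at 0. *)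
Lemma radial_diff_surj q n p : q != 1 -> (size p <= n)%N ->
  exists g : {poly R}, [/\ (size g <= n.+1)%N, g.[0] = 0 & radial_diff q g = p].
Proof.
move=> q_neq1; elim: n p => [|n IHn] p sz_p.
  exists 0; rewrite size_poly0 horner0; split=> //.
  have /eqP-> : p == 0 by rewrite -size_poly_leq0.
  by rewrite /radial_diff !comp_poly0 !scaler0; ring.
pose c := p`_n / ((1 - q) * n.+1%:R); pose m : {poly R} := c *: 'X^(n.+1).
have sz_m : (size m <= n.+2)%N.
  by rewrite (leq_trans (size_scale_leq _ _)) // size_polyXn.
have sz_rest : (size (p - radial_diff q m)%R <= n)%N.
  apply/leq_sizeP => j; rewrite leq_eqVlt => /predU1P[<-|lt_nj]; rewrite coefB.
    rewrite coef_radial_diff // /m coefZ coefXn eqxx mulr1 /c.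
    have n0 : 1 - q != 0 by rewrite subr_eq0 eq_sym.
    have n1 : n.+1%:R != 0 :> R by rewrite pnatr_eq0.
    by rewrite mulrC divfK ?subrr // mulf_neq0.
  by rewrite !nth_default ?subrr // (leq_trans _ lt_nj) // size_radial_diff.
have [g [sz_g g0 gE]] := IHn _ sz_rest.
(* The double negation lets additivity be read off from [radial_diffB]. *)
exists (g - - m); split.
- rewrite opprK (leq_trans (size_polyD _ _)) // geq_max sz_m andbT.
  exact: leq_trans sz_g _.
- by rewrite opprK hornerD g0 /m !hornerE ?expr0n /= ?mulr0 ?addr0.
- by rewrite radial_diffB gE -[- m]add0r radial_diffB /radial_diff
    !comp_poly0 !scaler0; ring.
Qed.
End Shift.

(** * The polynomials gamma_i *)

Section Gamma.
Context (R : realType) (q : nat).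
Implicit Types (p : {poly R}) (i j m n : nat).

(** The left-hand side of the linear systems, and the factor of (q+1)^i in
    [gamma_weight]. *)
Definition reflected_sum p m : R := p.[m%:R] + q%:R ^+ m * p.[- m%:R].

Lemma reflected_sum0 p : reflected_sum p 0 = 2 * p.[0].
Proof. by rewrite /reflected_sum /= oppr0; ring. Qed.

Lemma reflected_sum1 p :
  reflected_sum p 1 = (q%:R + 1) * p.[0] + (radial_diff q%:R p).[0].
Proof. by rewrite /reflected_sum horner_radial_diff !add0r; ring. Qed.

(** Both m |-> p(m) and m |-> q^m p(-m) turn [radial_diff] into the same
    operator u(m+1) - (q+1) u(m) + q u(m-1). *)
Lemma reflected_sumSS p m : reflected_sum p m.+2 =
  reflected_sum (radial_diff q%:R p) m.+1 + (q%:R + 1) * reflected_sum p m.+1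
  - q%:R * reflected_sum p m.
Proof.
rewrite /reflected_sum !horner_radial_diff.
have e1 : m.+1%:R + 1 = m.+2%:R :> R by rewrite natr1.
have e2 : m.+1%:R - 1 = m%:R :> R by rewrite -natr1 addrK.
have e3 : - m.+1%:R + 1 = - m%:R :> R by rewrite -e2; ring.
have e4 : - m.+1%:R - 1 = - m.+2%:R :> R by rewrite -e1; ring.
by rewrite e1 e2 e3 e4 !exprS; ring.
Qed.

Lemma is_gammaP i p : is_gamma q i p <->
  (size p <= i.+1)%N /\ forall j, (j <= i)%N ->
    reflected_sum p j = if (j < i)%N then 0 else if i == 0%N then 2 else 1.
Proof.
have E : (size p <= i.+1)%N -> forall j, reflected_sum p j =
    \sum_(m < i.+1) j%:R ^+ m * (1 + (-1) ^+ m * q%:R ^+ j) * p`_m.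
  move=> sz_p j; rewrite /reflected_sum !(horner_coef_wide _ sz_p) mulr_sumr.
  rewrite -big_split /=; apply: eq_bigr => m _.
  by rewrite (exprNn j%:R); ring.
by split=> -[sz_p p_eqs]; split=> // j /p_eqs; rewrite E.
Qed.

(** The equations for the image come from [reflected_sumSS], except for j = 0:
    since p(0) = 0, the reflected sum of the image at 0 is twice that of [p] at 1.
    For i = 0 this is 2 * 1, the exceptional right-hand side 2. *)
Lemma radial_diff_gamma i p : is_gamma q i.+1 p ->
  is_gamma q i (radial_diff q%:R p).
Proof.
move=> /is_gammaP[sz_p pE]; apply/is_gammaP; split; first exact: size_radial_diff.
have p0 : reflected_sum p 0 = 0 by rewrite pE.
case=> [_|j lt_ji].
  have root0 : p.[0] = 0 by have := p0; rewrite reflected_sum0 => h; lra.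
  have := pE 1%N isT; rewrite reflected_sum1 reflected_sum0 root0 mulr0 add0r => ->.
  by case: (i) => [|k] /=; ring.
have vanish k : (k <= i)%N -> reflected_sum p k = 0.
  by move=> le_ki; rewrite pE ?ltnS ?le_ki // ltnW.
have := reflected_sumSS p j; rewrite pE // !ltnS !vanish ?mulr0 ?addr0 ?subr0 //.
  by move=> <-; case: (i) lt_ji.
exact: ltnW.
Qed.

(** By induction, [radial_diff] kills the difference of two solutions, which is
    therefore constant; the equation j = 0 makes that constant 0. *)
Lemma is_gamma_unique i p1 p2 : q%:R != 1 :> R ->
  is_gamma q i p1 -> is_gamma q i p2 -> p1 = p2.
Proof.
move=> q_neq1; elim: i p1 p2 => [|i IHi] p1 p2 g1 g2.
  case/is_gammaP: g1 => /size1_polyC -> /(_ 0%N isT).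
  case/is_gammaP: g2 => /size1_polyC -> /(_ 0%N isT).
  by rewrite !reflected_sum0 !hornerC /= => e2 e1; congr _%:P; lra.
have /eqP := IHi _ _ (radial_diff_gamma g1) (radial_diff_gamma g2).
rewrite -subr_eq0 -radial_diffB => /eqP/(radial_diff_eq0 q_neq1) /size1_polyC.
case/is_gammaP: g1 => _ /(_ 0%N isT); case/is_gammaP: g2 => _ /(_ 0%N isT).
rewrite !reflected_sum0 /= => e2 e1; move: (p1 - p2)`_0 => c /eqP p12.
have {}p12 : p1 = p2 + c%:P by apply/eqP; rewrite addrC -subr_eq.
have c0 : c = 0 by move: e1; rewrite p12 hornerD hornerC => e1; lra.
by rewrite p12 c0 addr0.
Qed.

(** The preimage under [radial_diff] of the previous solution that vanishes at 0
    satisfies the equations j = 0 and j = 1, and the others follow from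
    [reflected_sumSS]. *)
Lemma is_gamma_exists i : q%:R != 1 :> R -> exists p : {poly R}, is_gamma q i p.
Proof.
move=> q_neq1; elim: i => [|i [p /is_gammaP[sz_p pE]]].
  exists 1; apply/is_gammaP; split; first by rewrite size_poly1.
  by case=> // _; rewrite reflected_sum0 hornerC mulr1.
have [g [sz_g g0 gE]] := radial_diff_surj q_neq1 sz_p.
exists g; apply/is_gammaP; split=> //.
have e0 : reflected_sum g 0 = 0 by rewrite reflected_sum0 g0 mulr0.
have e1 : reflected_sum g 1 = if i == 0%N then 1 else 0.
  rewrite reflected_sum1 g0 gE.
  by have := pE 0%N isT; rewrite reflected_sum0; case: (i) => [|k] /= h; lra.
(* The recursion has order two, so two consecutive equations are carried. *)
suff both j : ((j <= i.+1)%N ->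
    reflected_sum g j = if (j < i.+1)%N then 0 else 1) /\ ((j.+1 <= i.+1)%N ->
    reflected_sum g j.+1 = if (j.+1 < i.+1)%N then 0 else 1).
  by move=> j /(both j).1.
elim: j => [|j [IHj IHj1]]; split=> //.
  by rewrite e1; case: (i).
move=> lt_ji; have lt_ji' : (j < i)%N by [].
rewrite reflected_sumSS gE IHj1 ?IHj ?pE; try lia.
rewrite !ltnS lt_ji' (ltnW lt_ji') (_ : (i == 0%N) = false); last by lia.
by rewrite !mulr0 addr0 subr0.
Qed.

Lemma gamma_radial_diff (gamma : nat -> {poly R}) i : q%:R != 1 :> R ->
  (forall i, is_gamma q i (gamma i)) ->
  radial_diff q%:R (gamma i.+1) = gamma i.
Proof.
move=> q_neq1 gammaP.
exact: is_gamma_unique (radial_diff_gamma (gammaP i.+1)) (gammaP i).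
Qed.

(** The expansion of x^m + y^m in powers of T = x + y - (q+1), with x = q E and
    y = E^-1, applied to the sequence [K 0]; the hypothesis says that
    [K i] is T^i applied to [K 0], which only makes sense at positive indices,
    whence m <= n.  The induction is on the recursion
    x^{m+2} + y^{m+2} = (T+q+1) (x^{m+1} + y^{m+1}) - q (x^m + y^m), in which
    the factor T is absorbed by replacing [K] with its shift in i.  The number
    [N] of terms is left free above m, which spares adjusting it at each step:
    the extra terms vanish. *)
Lemma gamma_inversion (gamma : nat -> {poly R}) N m n
    (K : nat -> nat -> R) :
  q%:R != 1 :> R -> (forall i, is_gamma q i (gamma i)) ->
  (forall i n, K i.+1 n.+1 =
    q%:R * K i n.+2 + K i n - (q%:R + 1) * K i n.+1) ->
  (m < N)%N -> (m <= n)%N ->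
  \sum_(i < N) reflected_sum (gamma i) m * K i n =
    K 0%N (n - m)%N + q%:R ^+ m * K 0%N (n + m)%N.
Proof.
move=> q_neq1 gammaP.
have gamma0 : gamma 0%N = 1.
  apply: (is_gamma_unique q_neq1 (gammaP _)); apply/is_gammaP.
  split; first by rewrite size_poly1.
  by case=> // _; rewrite reflected_sum0 hornerC mulr1.
have at0 i : reflected_sum (gamma i.+1) 0 = 0.
  by have /is_gammaP[_ ->] := gammaP i.+1.
have at0' i : (gamma i.+1).[0] = 0.
  by have := at0 i; rewrite reflected_sum0; lra.
have radE i := gamma_radial_diff i q_neq1 gammaP.
have rad0 : radial_diff q%:R (gamma 0%N) = 0.
  by rewrite gamma0 /radial_diff -polyC1 !comp_polyC -!mul_polyC polyCD; ring.
suff both m' : forall N n K, (forall i n, K i.+1 n.+1 =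
      q%:R * K i n.+2 + K i n - (q%:R + 1) * K i n.+1) ->
    ((m' < N)%N -> (m' <= n)%N ->
    \sum_(i < N) reflected_sum (gamma i) m' * K i n =
      K 0%N (n - m')%N + q%:R ^+ m' * K 0%N (n + m')%N) /\
    ((m'.+1 < N)%N -> (m'.+1 <= n)%N ->
    \sum_(i < N) reflected_sum (gamma i) m'.+1 * K i n =
      K 0%N (n - m'.+1)%N + q%:R ^+ m'.+1 * K 0%N (n + m'.+1)%N).
  by move=> Krec; exact: (both m N n K Krec).1.
elim: m' => [|m' IHm] {}N {}n {}K Krec; split=> //.
- case: N => // N _ _; rewrite big_ord_recl big1 => [|i _]; last first.
    by rewrite at0 mul0r.
  by rewrite reflected_sum0 gamma0 hornerC subn0 addn0; ring.
- case: N => [|[|N]] // _; case: n => // n _.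
  rewrite !big_ord_recl big1 => [|i _]; last first.
    by rewrite reflected_sum1 radE !at0'; ring.
  rewrite !reflected_sum1 rad0 radE at0' gamma0 !hornerC /= Krec.
  by rewrite subSS subn0 addn1; ring.
- by move=> lt_mN le_mn; exact: (IHm N n K Krec).2.
- case: N => // N; rewrite ltnS => lt_mN lt_mn.
  under eq_bigr => i _ do rewrite reflected_sumSS.
  (* The first sum is T (x^{m'+1} + y^{m'+1}), re-indexed. *)
  transitivity (\sum_(i < N) reflected_sum (gamma i) m'.+1 * K i.+1 n
     + (q%:R + 1) * (\sum_(i < N.+1) reflected_sum (gamma i) m'.+1 * K i n)
     - q%:R * (\sum_(i < N.+1) reflected_sum (gamma i) m' * K i n)).
    rewrite !mulr_sumr -addrA -sumrB.
    rewrite [in RHS]big_ord_recl [in LHS]big_ord_recl rad0.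
    rewrite [X in _ = _ + (_ + X)](_ : _ =
      \sum_(i < N) ((q%:R + 1) * (reflected_sum (gamma i.+1) m'.+1 * K i.+1 n)
      - q%:R * (reflected_sum (gamma i.+1) m' * K i.+1 n))) //.
    rewrite addrCA -big_split /=; congr (_ + _).
      by rewrite /reflected_sum !horner0; ring.
    by apply: eq_bigr => i _; rewrite radE; ring.
  have Krec1 i k : K i.+2 k.+1 =
    q%:R * K i.+1 k.+2 + K i.+1 k - (q%:R + 1) * K i.+1 k.+1 by exact: Krec.
  rewrite (IHm N n (fun i => K i.+1) Krec1).2 //; last exact: ltnW.
  rewrite (IHm N.+1 n K Krec).2 //; [|by lia|exact: ltnW].
  rewrite (IHm N.+1 n K Krec).1 //; [|by lia|by lia].
  have -> : (n - m'.+1 = (n - m'.+2).+1)%N by lia.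
  have -> : (n - m' = (n - m'.+2).+2)%N by lia.
  by rewrite !addnS !Krec !exprS; ring.
Qed.
End Gamma.

(** * Bridges in acyclic graphs *)

Section Joined.
Context (V : choiceType).
Implicit Types (e : rel V) (x y z u t : V).

(** Connectedness for graphs that may be infinite; [cone adj v w u] is by
    definition [joined (delete_edge adj v w) v u]. *)
Definition joined e x y : Prop := exists2 p : seq V, path e x p & last x p = y.

Lemma joined_refl e x : joined e x x. Proof. by exists [::]. Qed.

Lemma joined_trans e y x z : joined e x y -> joined e y z -> joined e x z.
Proof.
move=> [p xp lp] [r yr lr]; exists (p ++ r); last by rewrite last_cat lp.
by rewrite cat_path xp lp.
Qed.

Lemma joined1 e x y : e x y -> joined e x y.
Proof. by move=> exy; exists [:: y] => //=; rewrite exy. Qed.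

Lemma joined_sym e x y : symmetric e -> joined e x y -> joined e y x.
Proof.
move=> e_sym [p xp <-]; exists (rev (belast x p)).
  by rewrite rev_path (eq_path (e' := e)) // => s t; rewrite e_sym.
by case: p xp => //= z p _; rewrite rev_cons last_rcons.
Qed.

Lemma delete_edge_sym e x y : symmetric e -> symmetric (delete_edge e x y).
Proof.
by move=> e_sym s t; rewrite /delete_edge e_sym orbC (andbC (t == y)) (andbC (t == x)).
Qed.

(** A detour from [x] to [y] without repeated vertices, closed up by the edge,
    would be a cycle with at least three vertices. *)
Lemma acyclic_bridge e x y : symmetric e ->
  (forall c, ucycle e c -> (size c <= 2)%N) -> e x y -> x != y ->
  ~ joined (delete_edge e x y) x y.
Proof.
move=> e_sym acyclic exy neq_xy [p /shortenP[r xr uniq_r _] last_r].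
have e_r : path e x r by apply: sub_path xr => s t /andP[].
have : ucycle e (x :: r).
  by apply/andP; rewrite /= rcons_path e_r last_r e_sym.
move/acyclic => /=; case: r xr last_r {uniq_r e_r} => [|z [|//]] /=.
  by move=> _ /eqP; rewrite (negPf neq_xy).
by move=> + zy; rewrite zy /delete_edge !eqxx /= andbF.
Qed.

End Joined.

(** * Depth in a rooted tree *)

Section Tree.
Context (V : choiceType) (adj : rel V) (q : nat) (v : V).
Context (tree : homogeneous_tree adj q).
Implicit Types (x y u t a b : V).

Let adj_sym : symmetric adj. Proof. by case: tree. Qed.
Let adj_irr : irreflexive adj. Proof. by case: tree. Qed.

Definition has_walk u n : bool :=
  `[< exists p : seq V, [/\ path adj v p, last v p = u & size p = n] >].

Lemma has_walk_exists u : exists n, has_walk u n.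
Proof.
have [_ _ /(_ v u)[p vp lp] _ _] := tree.
by exists (size p); apply/asboolP; exists p.
Qed.

Definition depth u : nat := ex_minn (has_walk_exists u).

Lemma depth_walk u :
  exists p : seq V, [/\ path adj v p, last v p = u & size p = depth u].
Proof. by rewrite /depth; case: ex_minnP => n /asboolP. Qed.

Lemma depth_le_size (p : seq V) : path adj v p -> (depth (last v p) <= size p)%N.
Proof.
move=> vp; rewrite /depth; case: ex_minnP => n _; apply.
by apply/asboolP; exists p.
Qed.

Lemma sphereE n u : sphere adj n v u <-> depth u = n.
Proof.
have [p [vp lp sp]] := depth_walk u; split=> [[[r [vr lr sr]] min]|<-].
  apply/eqP; rewrite eqn_leq -{2}sp (min p) // andbT -sr.
  by rewrite -{1}lr depth_le_size.
by split=> [|r vr lr]; [exists p | rewrite -lr depth_le_size].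
Qed.

Lemma depth_root : depth v = 0%N.
Proof. by apply/eqP; rewrite -leqn0; apply: (@depth_le_size [::]). Qed.

Lemma depth_eq0 u : depth u = 0%N -> u = v.
Proof.
by have [p [_ <- sp]] := depth_walk u => du; move: sp; rewrite du => /size0nil->.
Qed.

Lemma depth_adj t u : adj t u -> (depth u <= (depth t).+1)%N.
Proof.
have [p [vp lp <-]] := depth_walk t => tu.
have := @depth_le_size (rcons p u); rewrite last_rcons size_rcons; apply.
by rewrite rcons_path vp lp.
Qed.

Lemma depth_parent u n : depth u = n.+1 -> exists2 t, adj t u & depth t = n.
Proof.
have [p [vp lp sp]] := depth_walk u => du; rewrite du in sp.
case/lastP: p vp lp sp => // p z; rewrite rcons_path last_rcons size_rcons.
move=> /andP[vp zu] zE [sp]; rewrite zE in zu; exists (last v p) => //.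
apply/eqP; rewrite eqn_leq -{1}sp depth_le_size //=.
by have := depth_adj zu; rewrite du.
Qed.

(** A geodesic from the root to [u] only meets vertices less deep than [u]
    before [u], hence avoids [x], and a fortiori any edge at [x]. *)
Lemma joined_root x y u : u != x -> (depth u <= depth x)%N ->
  joined (delete_edge adj x y) v u.
Proof.
have [n] := ubnP (depth u); elim: n u => // n IHn u lt_un neq_ux le_ux.
case du: (depth u) => [|k]; first by rewrite (depth_eq0 du); apply: joined_refl.
have [t tu dt] := depth_parent du.
have neq_tx : t != x by apply: contraTneq le_ux => <-; rewrite du dt ltnn.
apply: (@joined_trans _ _ t).
  by apply: IHn => //; [move: lt_un | move: le_ux]; rewrite du dt; lia.
apply: joined1; rewrite /delete_edge tu (negPf neq_tx) (negPf neq_ux) /=.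
by rewrite andbF.
Qed.

(** Two such neighbours [a] and [b] would yield a detour u, b, root, a around
    the edge [u a], which is a bridge. *)
Lemma upward_neighbor_unique u a b : adj u a -> adj u b ->
  (depth a <= depth u)%N -> (depth b <= depth u)%N -> a = b.
Proof.
move=> ua ub le_au le_bu; apply/eqP; apply: contraT => neq_ab.
have neq t : adj u t -> t != u by move=> ut; apply: contraTneq ut => ->; rewrite adj_irr.
have [_ _ _ acyclic _] := tree.
exfalso; apply: (acyclic_bridge adj_sym acyclic ua); first by rewrite eq_sym neq.
apply: (@joined_trans _ _ b).
  by apply: joined1; rewrite /delete_edge ub (eq_sym b a) (eq_sym u a) (negPf neq_ab)
    (negPf (neq a ua)) andbF.
apply: (@joined_trans _ _ v); last exact: joined_root (neq a ua) le_au.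
by apply: joined_sym; [exact: delete_edge_sym | exact: joined_root (neq b ub) le_bu].
Qed.

(** The parent of [u] already is the unique neighbour that is not deeper. *)
Lemma depth_adj_neq u t : adj u t -> depth t <> depth u.
Proof.
move=> ut dE; case du: (depth u) => [|n].
  by move: ut; rewrite (depth_eq0 du) (depth_eq0 (etrans dE du)) adj_irr.
have [p pu dp] := depth_parent du.
suff pt : p = t by move: dE; rewrite -pt dp du => /n_Sn.
by apply: (@upward_neighbor_unique u); rewrite ?[adj u p]adj_sym ?dE ?dp ?du.
Qed.

(** * Spheres of a cone *)

Section Cone.
Context (w : V).
Context (vw : adj v w).

Lemma cone_adj u t : adj u t -> cone adj v w u ->
  ~~ ((u == v) && (t == w) || (u == w) && (t == v)) -> cone adj v w t.
Proof.
move=> ut uC not_vw; apply: (joined_trans uC); apply: joined1.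
by rewrite /delete_edge ut.
Qed.

Lemma cone_opposite : ~ cone adj v w w.
Proof.
have [_ _ _ acyclic _] := tree => wC.
suff neq_vw : v != w by exact: (acyclic_bridge adj_sym acyclic vw neq_vw wC).
by apply/eqP => vE; move: vw; rewrite -vE adj_irr.
Qed.

Lemma cone_sphereE n u : cone_sphere adj v w n u <-> cone adj v w u /\ depth u = n.
Proof. by split=> -[uC /sphereE]. Qed.

Lemma cone_sphere0 : cone_sphere adj v w 0 = [set v].
Proof.
apply/seteqP; split=> u /=; first by move=> /cone_sphereE[_ /depth_eq0].
by move=> ->; apply/cone_sphereE; split; [apply: joined_refl | apply: depth_root].
Qed.

Lemma cone_neighbor n u t : cone_sphere adj v w n.+1 u -> adj u t ->
  cone_sphere adj v w n t \/ cone_sphere adj v w n.+2 t.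
Proof.
move=> /cone_sphereE[uC du] ut.
have tC : cone adj v w t.
  apply: (cone_adj ut uC); rewrite negb_or !negb_and; apply/andP; split.
    by apply/orP; left; apply: contra_eqN du => /eqP->; rewrite depth_root.
  by apply/orP; left; apply/eqP => uw; apply: cone_opposite; rewrite -{2}uw.
have := depth_adj ut; have := depth_adj_neq ut.
move: (ut); rewrite adj_sym => /depth_adj; rewrite du => l1 l2 l3.
have [dt|dt] : depth t = n \/ depth t = n.+2 by lia.
  by left; apply/cone_sphereE.
by right; apply/cone_sphereE.
Qed.

Lemma cone_parent n u : cone_sphere adj v w n.+1 u ->
  exists2 p, cone_sphere adj v w n p &
    forall t, cone_sphere adj v w n t /\ adj t u <-> t = p.
Proof.
move=> uCn; have [_ du] := (cone_sphereE _ _).1 uCn.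
have [p pu dp] := depth_parent du; have up : adj u p by rewrite adj_sym.
have pCn : cone_sphere adj v w n p.
  by case: (cone_neighbor uCn up) => // /cone_sphereE[_]; rewrite dp; lia.
exists p => // t; split=> [[/cone_sphereE[_ dt] tu]|-> //].
by apply: (@upward_neighbor_unique u); rewrite ?[adj u t]adj_sym ?dt ?dp ?du.
Qed.

(** The excluded neighbour [p] is the parent of [u] or, when [u] is the root of the
    cone, the other end [w] of the deleted edge; either way q neighbours are
    left. *)
Lemma cone_children n u : cone_sphere adj v w n u ->
  exists2 p, adj u p &
    forall t, cone_sphere adj v w n.+1 t /\ adj t u <-> adj u t /\ t != p.
Proof.
case: n => [|n] uCn.
  move: uCn; rewrite cone_sphere0 => ->; exists w => // t; split.
    move=> [/cone_sphereE[tC _] tv]; rewrite adj_sym; split=> //.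
    by apply/eqP => tw; apply: cone_opposite; rewrite -{2}tw.
  move=> [vt neq_tw]; split; last by rewrite adj_sym.
  apply/cone_sphereE; split.
    apply: (cone_adj vt (joined_refl _ _)); rewrite (negPf neq_tw) andbF /=.
    by rewrite negb_and; apply/orP; left; apply/eqP => vE; move: vw; rewrite -vE adj_irr.
  have := depth_adj vt; have := depth_adj_neq vt; rewrite depth_root; lia.
have [p pCn pP] := cone_parent uCn.
have [_ pu] := (pP p).2 erefl; exists p; first by rewrite adj_sym.
move=> t; split=> [[tCn tu]|[ut neq_tp]].
  rewrite adj_sym; split=> //; apply: contraPneq tCn => -> /cone_sphereE[_ dp].
  by have [/cone_sphereE[_]] := (pP p).2 erefl; rewrite dp; lia.
split; last by rewrite adj_sym.
case: (cone_neighbor uCn ut) => // tCn; move: neq_tp.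
by rewrite ((pP t).1 _) ?eqxx // adj_sym.
Qed.

Lemma neighbors_finite u : finite_set [set t | adj u t].
Proof. by have [_ _ _ _ /(_ u) card_u] := tree; exists q.+1. Qed.

Lemma cone_sphere_finite n : finite_set (cone_sphere adj v w n).
Proof.
elim: n => [|n IHn]; first by rewrite cone_sphere0; exact: finite_set1.
apply: (@sub_finite_set _ _
  (\bigcup_(u in cone_sphere adj v w n) [set t | adj u t])).
  move=> t /cone_parent[p pCn pP]; exists p => //=.
  by have [_] := (pP p).2 erefl.
by apply: bigcup_finite => // u _; exact: neighbors_finite.
Qed.

(** * The Laplacian on cone means *)

Section Sums.
Context (R : realType).
Implicit Types g : V -> R.

Definition cone_sum g n : R := \sum_(u \in cone_sphere adj v w n) g u.

Lemma sum_parents n t : cone_sphere adj v w n.+1 t ->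
  \sum_(u \in cone_sphere adj v w n) ((adj u t)%:R : R) = 1.
Proof.
move=> /cone_parent[p pCn pP].
transitivity (\sum_(u \in [set p]) ((adj u t)%:R : R)); last first.
  by rewrite fsbig_set1; have [_ ->] := (pP p).2 erefl.
symmetry; apply: fsbig_widen => [u -> //|u [uCn neq_up]] /=.
by case ut: (adj u t) => //; case: neq_up; apply/pP.
Qed.

Lemma sum_children n t : cone_sphere adj v w n t ->
  \sum_(u \in cone_sphere adj v w n.+1) ((adj u t)%:R : R) = q%:R.
Proof.
move=> /cone_children[p tp pP].
have [_ _ _ _ /(_ t) card_t] := tree.
have : \sum_(u \in [set u | adj t u]) (1 : R) = q.+1%:R.
  rewrite fsbig_finite; last exact: neighbors_finite.
  by rewrite big_const_seq count_predT [size _](card_fset_set card_t) iter_addr_0.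
rewrite (fsbigD1 p) //=; last exact: neighbors_finite.
rewrite -natr1 addrC => /addIr <-.
transitivity (\sum_(u \in [set u | adj t u] `\ p) ((adj u t)%:R : R)).
  symmetry; apply: fsbig_widen => [u [tu /eqP neq_up]|u [uCn not_child]] /=.
    by have [] := (pP u).2 (conj tu neq_up).
  case ut: (adj u t) => //; case: not_child.
  by have [tu /eqP neq_up] := (pP u).1 (conj uCn ut).
by apply: eq_fsbigr => u; rewrite inE adj_sym => -[-> _].
Qed.

(** Double counting of the edges that leave C_{n+1}. *)
Lemma cone_sum_neighbors g n :
  \sum_(u \in cone_sphere adj v w n.+1) \sum_(t \in [set t | adj u t]) g t
  = cone_sum g n.+2 + q%:R * cone_sum g n.
Proof.
pose below := cone_sphere adj v w n; pose above := cone_sphere adj v w n.+2.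
have split_neighbors u : cone_sphere adj v w n.+1 u ->
    \sum_(t \in [set t | adj u t]) g t =
    \sum_(t \in above) (adj u t)%:R * g t + \sum_(t \in below) (adj u t)%:R * g t.
  move=> uCn; rewrite -fsbigU0; [|exact: cone_sphere_finite..|]; last first.
    move=> t [/cone_sphereE[_ dt] /cone_sphereE[_]]; rewrite dt => /eqP.
    by rewrite -addn2 -[eqbRHS]addn0 eqn_add2l.
  transitivity (\sum_(t \in [set t | adj u t]) (adj u t)%:R * g t).
    by apply: eq_fsbigr => t; rewrite inE => /= ->; rewrite mul1r.
  apply: fsbig_widen => [t ut|t [_ /= not_ut]] /=.
    by case: (cone_neighbor uCn ut); [right | left].
  by case: (adj u t) not_ut => //= _; rewrite mul0r.
transitivity (\sum_(u \in cone_sphere adj v w n.+1)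
    (\sum_(t \in above) (adj u t)%:R * g t +
     \sum_(t \in below) (adj u t)%:R * g t)).
  by apply: eq_fsbigr => u; rewrite inE; exact: split_neighbors.
rewrite fsbig_split /=; last exact: cone_sphere_finite.
rewrite mulr_fsumr; congr (_ + _);
  (rewrite exchange_fsbig; [|exact: cone_sphere_finite..]);
  apply: eq_fsbigr => t; rewrite inE => tC; rewrite -mulr_fsuml.
- by rewrite sum_parents ?mul1r.
- by rewrite sum_children.
Qed.

(** The root is excluded: its neighbour [w], which lies outside the cone, enters
    the Laplacian there. *)
Lemma cone_mean_laplace g n : (1 < q)%N ->
  q.+1%:R * cone_mean adj q (laplace adj q g) v w n.+1 =
  q%:R * cone_mean adj q g v w n.+2 + cone_mean adj q g v w n
  - (q%:R + 1) * cone_mean adj q g v w n.+1.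
Proof.
move=> q_gt1; rewrite /cone_mean -!/(cone_sum _ _).
have q0 : q%:R != 0 :> R by rewrite pnatr_eq0; lia.
have q1 : q%:R + 1 != 0 :> R by rewrite natr1 pnatr_eq0.
have -> : cone_sum (laplace adj q g) n.+1 =
    q.+1%:R^-1 * (cone_sum g n.+2 + q%:R * cone_sum g n) - cone_sum g n.+1.
  rewrite -cone_sum_neighbors mulr_fsumr /cone_sum /laplace.
  rewrite fsbig_split /=; last exact: cone_sphere_finite.
  congr (_ + _); rewrite -mulN1r mulr_fsumr.
  by apply: eq_fsbigr => u _; rewrite mulN1r.
rewrite -natr1 !exprS; field.
by rewrite expf_neq0 // q0 q1.
Qed.

End Sums.
End Cone.
End Tree.

(** * Inversion formula *)

Lemma gamma_weight_sum (R : realType) (q : nat) (V : choiceType) (adj : rel V)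
    (gamma : nat -> {poly R}) (v w : V) (f : V -> R) (n : nat) :
  (1 < q)%N -> homogeneous_tree adj q -> adj v w ->
  (forall i, is_gamma q i (gamma i)) ->
  \sum_(i < n.+1)
     gamma_weight q gamma i n * cone_mean adj q (iter i (laplace adj q) f) v w n
  = f v + q%:R ^+ n * cone_mean adj q f v w (2 * n).
Proof.
move=> q_gt1 tree vw gammaP.
pose K i k : R :=
  q.+1%:R ^+ i * cone_mean adj q (iter i (laplace adj q) f) v w k.
transitivity (\sum_(i < n.+1) reflected_sum q (gamma i) n * K i n).
  by apply: eq_bigr => i _; rewrite /gamma_weight /K /reflected_sum; ring.
have q_neq1 : q%:R != 1 :> R by rewrite (eqr_nat R q 1); lia.
have Krec i k : K i.+1 k.+1 =
    q%:R * K i k.+2 + K i k - (q%:R + 1) * K i k.+1.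
  rewrite /K exprSr -mulrA (cone_mean_laplace tree vw) //; ring.
rewrite (gamma_inversion q_neq1 gammaP Krec) // subnn addnn -mul2n /K !expr0 !mul1r.
by rewrite [X in X + _]/cone_mean (cone_sphere0 v tree) fsbig_set1 expr0 invr1 mul1r.
Qed.

Theorem theoremB (R : realType) (q : nat) (hq : (1 < q)%N)
    (V : choiceType) (adj : rel V) (hT : homogeneous_tree adj q) :
  (forall i : nat, exists! p : {poly R}, is_gamma q i p) /\
  (forall gamma : nat -> {poly R},
     (forall i : nat, is_gamma q i (gamma i)) ->
   forall (v w : V) (f : V -> R), adj v w ->
     (horosummable adj q v w f ->
        horocyclic_integral_is adj q v w (gamma_weight q gamma) f (f v)) /\
     (horocyclic_integral_is adj q v w (gamma_weight q gamma) f (f v) <->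
        horosummable adj q v w f)).
Proof.
split=> [i|gamma gammaP v w f vw].
  have q_neq1 : q%:R != 1 :> R by rewrite (eqr_nat R q 1); lia.
  have [p pP] := is_gamma_exists i q_neq1.
  by exists p; split=> // p'; exact: is_gamma_unique.
suff integralE : horocyclic_integral_is adj q v w (gamma_weight q gamma) f (f v)
    <-> horosummable adj q v w f by split=> // /integralE.
rewrite /horocyclic_integral_is /horosummable.
under eq_fun => n do rewrite (gamma_weight_sum _ _ hq hT vw gammaP).
set a := fun n : nat => q%:R ^+ n * _.
split=> lim.
  have -> : a = (fun n => f v + a n) \- (fun=> f v).
    by apply/funext => n /=; ring.
  by rewrite -(subrr (f v)); apply: cvgB lim _; exact: cvg_cst.
by rewrite -[X in _ --> X]addr0; apply: cvgD lim; exact: cvg_cst.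
Qed.
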